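(* Let $f_1,\dots,f_n:\mathbb{R}^d\to\mathbb{R}$ be differentiable (possibly non-convex) and let $f=\frac1n\sum_{i=1}^nf_i$. Suppose that $f$ and $f_1,\dots,f_n$ are all $L$-smooth, that $f$ is bounded from below by $f_\ast\in\mathbb{R}$, and that there are constants $A,B\ge0$ such that $\frac1n\sum_{i=1}^n\|\nabla f_i(x)-\nabla f(x)\|^2\le2A(f(x)-f_\ast)+B^2$ for all $x\in\mathbb{R}^d$. Let $\delta_0=f(x_0)-f_\ast$ and $\varepsilon>0$. Run Random Reshuffling for $T\ge1$ epochs from $x_0\in\mathbb{R}^d$ with the stepsize $$\gamma=\min\left\{\frac{1}{2Ln},\ \frac{1}{A^{1/3}L^{2/3}n^{2/3}T^{1/3}},\ \frac{\varepsilon}{2L\sqrt n\,B}\right\}.$$ Then $$\min_{t=0,\dots,T-1}\mathbb{E}\left[\|\nabla f(x_t)\|^2\right]\le\varepsilon^2$$ provided the total number of iterations satisfies $$Tn\ge\frac{48\,\delta_0L\sqrt n}{\varepsilon^2}\max\left\{\sqrt n,\frac{\sqrt{6\delta_0A}}{\varepsilon},\frac{B}{\varepsilon}\right\}.$$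
   Context: $L$-smooth means that the gradient is $L$-Lipschitz. Terms with zero denominator in the minimum defining $\gamma$ (when $A=0$ or $B=0$) are read as $+\infty$. Random Reshuffling (RR): given a stepsize $\gamma>0$, a starting point $x_0\in\mathbb{R}^d$ and a number of epochs $T$, in each epoch $t=0,1,\dots,T-1$ sample afresh (independently) a uniformly random permutation $\pi=(\pi_0,\pi_1,\dots,\pi_{n-1})$ of $\{1,\dots,n\}$, set $x_t^0=x_t$, perform $x_t^{i+1}=x_t^i-\gamma\nabla f_{\pi_i}(x_t^i)$ for $i=0,1,\dots,n-1$, and set $x_{t+1}=x_t^n$. The expectation is over the random permutations. *)

(* Defs.v *)
From mathcomp Require Import all_boot all_order all_algebra all_fingroup.
From mathcomp Require Import all_classical all_reals all_analysis.

Set Implicit Arguments.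
Unset Strict Implicit.
Unset Printing Implicit Defensive.

Import Order.TTheory GRing.Theory Num.Theory.
Import numFieldNormedType.Exports.

Local Open Scope classical_set_scope.
Local Open Scope ring_scope.

(* The canonical norm on 'rV[R]_d is the sup norm, whence a separate Euclidean
   norm; differentiability does not depend on this choice. *)
Definition enorm (R : realType) (d : nat) (v : 'rV[R]_d) : R :=
  Num.sqrt (\sum_(i < d) v 0 i ^+ 2).

Definition gradient (R : realType) (d : nat) (g : 'rV[R]_d -> R)
    (x : 'rV[R]_d) : 'rV[R]_d :=
  \row_(i < d) 'D_(delta_mx 0 i) g x.

Definition smooth (R : realType) (d : nat) (L : R) (g : 'rV[R]_d -> R) : Prop :=
  forall x y : 'rV[R]_d,
    enorm (gradient g x - gradient g y) <= L * enorm (x - y).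

Definition average (R : realType) (d n : nat) (f : 'I_n -> 'rV[R]_d -> R)
    (x : 'rV[R]_d) : R :=
  n%:R^-1 * \sum_(i < n) f i x.

(* [enum 'I_n] is 0, ..., n-1 in increasing order: the fold maps x_t = x_t^0
   to x_t^n = x_{t+1}. *)
Definition rr_epoch (R : realType) (d n : nat) (f : 'I_n -> 'rV[R]_d -> R)
    (gamma : R) (s : 'S_n) (x : 'rV[R]_d) : 'rV[R]_d :=
  foldl (fun y i => y - gamma *: gradient (f (s i)) y) x (enum 'I_n).

Fixpoint rr_iterate (R : realType) (d n : nat) (f : 'I_n -> 'rV[R]_d -> R)
    (gamma : R) (x0 : 'rV[R]_d) (pi : nat -> 'S_n) (t : nat) : 'rV[R]_d :=
  if t is t'.+1 then
    rr_epoch f gamma (pi t') (rr_iterate f gamma x0 pi t')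
  else x0.

(* Products and inverses of the last two terms are taken in \bar R, where
   0^-1 = +oo: those terms are +oo when A = 0, resp. B = 0. *)
Definition rr_stepsize (R : realType) (L A B eps : R) (n T : nat) : \bar R :=
  Order.min ((2 * L * n%:R)^-1)%:E
    (Order.min
      ((A `^ (1 / 3) * L `^ (2 / 3) * n%:R `^ (2 / 3) * T%:R `^ (1 / 3))%:E^-1)%E
      (eps%:E / (2 * L * Num.sqrt n%:R * B)%:E)%E).

(* A random element of a finite type E with its discrete sigma-algebra. *)
Definition discrete_rv (dO : measure_display) (Omega : measurableType dO)
    (E : finType) (X : Omega -> E) : Prop :=
  forall C : set E, measurable (X @^-1` C).

Definition uniform_rv (R : realType) (dO : measure_display)
    (Omega : measurableType dO) (P : probability Omega R)
    (E : finType) (X : Omega -> E) : Prop :=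
  forall e : E, P (X @^-1` [set e]) = ((#|E|%:R)^-1)%:E.

Definition mutually_independent (R : realType) (dO : measure_display)
    (Omega : measurableType dO) (P : probability Omega R)
    (I E : finType) (X : I -> Omega -> E) : Prop :=
  forall (J : {set I}) (C : I -> set E),
    P (\bigcap_(t in [set` J]) (X t @^-1` C t)) =
    (\prod_(t in J) P (X t @^-1` C t))%E.

(* Main.v *)
(* Conditionally on [x = x_t], the k-th inner iterate is [x] minus [gamma] times a
   partial sum of gradients.  Freezing these gradients at [x], the partial sum is
   a sample without replacement; distinct samples are nonpositively correlated,
   so its second moment is at most [k ^ 2 |grad f x|^2 + k sigma^2].  Hence the
   inner iterates drift little, and an epoch is a gradient step of size
   [gamma * n] with a small error, so that [delta t = E f(x_t) - fstar] satisfies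
     [delta t.+1 <= (1 + a) delta t - c E|grad f(x_t)|^2 + b]
   with [a T <= 4 / 3].  As [(1 + a) ^ T] stays bounded, if all the expected
   squared gradient norms exceeded [eps ^ 2] then [delta T] would be negative.
   Expectations are computed as averages over the finite set of [T]-tuples of
   permutations. *)
Require Import Defs.
From mathcomp Require Import all_boot all_order all_algebra all_fingroup.
From mathcomp Require Import all_classical all_reals all_analysis.
From mathcomp Require Import ring lra.
Import Order.TTheory GRing.Theory Num.Theory.
Import numFieldNormedType.Exports.
Local Open Scope classical_set_scope.
Local Open Scope ring_scope.

Set Implicit Arguments.
Unset Strict Implicit.
Unset Printing Implicit Defensive.

(** * Uniform averages over a finite type *)

Definition mean (R : realFieldType) (I : finType) (g : I -> R) : R :=
  #|I|%:R^-1 * \sum_(i : I) g i.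

Arguments mean R I g : clear implicits.

Lemma ler_mean (R : realFieldType) (I : finType) (g h : I -> R) :
  (forall i, g i <= h i) -> mean R I g <= mean R I h.
Proof.
move=> gh; apply: ler_wpM2l; first by rewrite invr_ge0 ler0n.
exact: ler_sum.
Qed.

Lemma eq_mean (R : realFieldType) (I : finType) (g h : I -> R) :
  g =1 h -> mean R I g = mean R I h.
Proof. by move=> gh; congr (_ * _); apply: eq_bigr => i _; rewrite gh. Qed.

Lemma mean_ge0 (R : realFieldType) (I : finType) (g : I -> R) :
  (forall i, 0 <= g i) -> 0 <= mean R I g.
Proof. by move=> g0; rewrite mulr_ge0 ?invr_ge0 ?ler0n// sumr_ge0. Qed.

Lemma meanD (R : realFieldType) (I : finType) (g h : I -> R) :
  mean R I (fun i => g i + h i) = mean R I g + mean R I h.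
Proof. by rewrite /mean big_split mulrDr. Qed.

Lemma meanZ (R : realFieldType) (I : finType) (a : R) (g : I -> R) :
  mean R I (fun i => a * g i) = a * mean R I g.
Proof. by rewrite /mean -mulr_sumr mulrCA. Qed.

Lemma mean_cst (R : realFieldType) (I : finType) (a : R) :
  (0 < #|I|)%N -> mean R I (fun=> a) = a.
Proof.
move=> I0; rewrite /mean sumr_const -[a *+ _]mulr_natl mulKf//.
by rewrite pnatr_eq0 -lt0n.
Qed.

Lemma mean_sum (R : realFieldType) (I J : finType) (Q : pred J)
    (g : J -> I -> R) :
  mean R I (fun i => \sum_(j | Q j) g j i) = \sum_(j | Q j) mean R I (g j).
Proof. by rewrite /mean exchange_big/= mulr_sumr. Qed.

Lemma exchange_mean (R : realFieldType) (I J : finType) (g : I -> J -> R) :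
  mean R I (fun i => mean R J (g i)) = mean R J (fun j => mean R I (g^~ j)).
Proof. by rewrite meanZ (mean_sum xpredT (fun j i => g i j)). Qed.

Lemma mean_shift (R : realFieldType) (I : finType) (g : I -> R) (h : I -> I) :
  injective h -> mean R I (fun i => g (h i)) = mean R I g.
Proof. by move=> hI; rewrite /mean [in RHS](reindex_inj hI). Qed.

(** * Moments of samples drawn without replacement by a uniform permutation *)

Lemma card_perm_gt0 (n : nat) : (0 < #|{perm 'I_n}|)%N.
Proof. by apply/card_gt0P; exists 1%g. Qed.

Lemma mean_perm_tperm (R : realFieldType) (n : nat) (g : 'I_n -> R)
    (i j : 'I_n) :
  mean R 'S_n (fun s => g (s i)) = mean R 'S_n (fun s => g (s j)).
Proof.
rewrite -(mean_shift _ (mulgI (tperm i j))); apply: eq_mean => s.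
by rewrite permM tpermL.
Qed.

(** By symmetry the left side is the same at every position [i], and summing over the positions
    gives a constant, as each permutation merely reorders the values of [g]. *)
Lemma mean_perm_point (R : realFieldType) (n : nat) (g : 'I_n -> R) (i : 'I_n) :
  mean R 'S_n (fun s => g (s i)) = mean R 'I_n g.
Proof.
have n0 : (n%:R : R) != 0 by rewrite pnatr_eq0; case: n i {g} => // -[].
apply: (mulfI n0); rewrite [in RHS]/mean card_ord mulVKf//.
transitivity (\sum_(j < n) mean R 'S_n (fun s => g (s j))).
  rewrite (eq_bigr (fun=> mean R 'S_n (fun s => g (s i)))); last first.
    by move=> j _; exact: mean_perm_tperm.
  by rewrite sumr_const card_ord mulr_natl.
rewrite -(mean_sum xpredT (fun j (s : 'S_n) => g (s j))).
rewrite -[RHS](@mean_cst R 'S_n _ (card_perm_gt0 n)).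
apply: eq_mean => s; rewrite [RHS](reindex_inj (@perm_inj _ s)).
by [].
Qed.

(* For fixed [i], the covariances over [j != i] all agree and sum to minus the
   variance, because a full sum of centered values vanishes. *)
Lemma mean_perm_cov_le0 (R : realFieldType) (n : nat) (c : 'I_n -> R)
    (i j : 'I_n) :
  \sum_(k < n) c k = 0 -> i != j ->
  mean R 'S_n (fun s => c (s i) * c (s j)) <= 0.
Proof.
move=> c0 ij.
set q := mean R 'S_n _.
have qE k : k != i -> mean R 'S_n (fun s => c (s i) * c (s k)) = q.
  move=> ki; rewrite /q -(mean_shift _ (mulgI (tperm k j))).
  by apply: eq_mean => s; rewrite !permM tpermL tpermD// eq_sym.
have sq : \sum_(k < n | k != i) q = - mean R 'S_n (fun s => c (s i) ^+ 2).
  rewrite -(eq_bigr _ qE).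
  rewrite -(mean_sum (fun k => k != i) (fun k (s : 'S_n) => c (s i) * c (s k))).
  rewrite -mulN1r -meanZ; apply: eq_mean => s.
  rewrite -mulr_sumr.
  have : \sum_(k < n) c (s k) = 0.
    by rewrite -[RHS]c0 [RHS](reindex_inj (@perm_inj _ s)).
  by rewrite (bigD1 i)//= => /eqP; rewrite addrC addr_eq0 => /eqP ->; ring.
have cn : (0 < #|[pred k : 'I_n | k != i]|)%N.
  by apply/card_gt0P; exists j; rewrite inE eq_sym.
move: sq; rewrite sumr_const => sq.
rewrite -(pmulrn_lle0 _ cn) sq oppr_le0.
by apply: mean_ge0 => s; exact: sqr_ge0.
Qed.

(** Expand the square: every diagonal term averages to the variance of [c], and the off-diagonal
    terms are nonpositive covariances. *)
Lemma mean_perm_sqr_centered (R : realFieldType) (n : nat) (c : 'I_n -> R)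
    (Q : pred 'I_n) :
  \sum_(k < n) c k = 0 ->
  mean R 'S_n (fun s => (\sum_(i | Q i) c (s i)) ^+ 2) <=
  #|Q|%:R * mean R 'I_n (fun i => c i ^+ 2).
Proof.
move=> c0.
have -> : mean R 'S_n (fun s => (\sum_(i | Q i) c (s i)) ^+ 2) =
   \sum_(i | Q i) \sum_(j | Q j) mean R 'S_n (fun s => c (s i) * c (s j)).
  rewrite -[RHS](eq_bigr _ (fun i _ => mean_sum Q
    (fun j (s : 'S_n) => c (s i) * c (s j)))).
  rewrite -(mean_sum Q
    (fun i (s : 'S_n) => \sum_(j | Q j) c (s i) * c (s j))).
  apply: eq_mean => s; rewrite expr2 mulr_suml; apply: eq_bigr => i _.
  by rewrite mulr_sumr.
rewrite mulr_natl -sumr_const [leRHS](eq_bigl Q)//; apply: ler_sum => i Qi.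
rewrite (bigD1 i)//= -[leRHS]addr0 lerD//.
  by rewrite -(mean_perm_point (fun k => c k ^+ 2) i) le_eqVlt; apply/orP; left.
by apply: sumr_le0 => j /andP[_ ji];
  apply: (mean_perm_cov_le0 c0); rewrite eq_sym.
Qed.

(** Split [u] into its mean and a centered part; the cross term averages to zero and the centered
    part falls under the previous bound. *)
Lemma mean_perm_sqr (R : realFieldType) (n : nat) (u : 'I_n -> R)
    (Q : pred 'I_n) :
  (0 < n)%N ->
  mean R 'S_n (fun s => (\sum_(i | Q i) u (s i)) ^+ 2) <=
  #|Q|%:R ^+ 2 * mean R 'I_n u ^+ 2 +
  #|Q|%:R * mean R 'I_n (fun i => (u i - mean R 'I_n u) ^+ 2).
Proof.
move=> n0; set m := mean R 'I_n u; set k := #|Q|%:R.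
pose c i := u i - m.
have nR0 : (n%:R : R) != 0 by rewrite pnatr_eq0 -lt0n.
have c0 : \sum_(i < n) c i = 0.
  rewrite sumrB sumr_const card_ord /m /mean card_ord -[_ *+ n]mulr_natl.
  by rewrite mulVKf// subrr.
have E (s : 'S_n) : (\sum_(i | Q i) u (s i)) ^+ 2 =
  k ^+ 2 * m ^+ 2 + (2 * k * m * \sum_(i | Q i) c (s i) +
    (\sum_(i | Q i) c (s i)) ^+ 2).
  have -> : \sum_(i | Q i) u (s i) = k * m + \sum_(i | Q i) c (s i).
    rewrite sumrB/= sumr_const -[m *+ _]mulr_natl -/k.
    by rewrite addrCA subrr addr0.
  by ring.
rewrite (eq_mean E) meanD (mean_cst _ (card_perm_gt0 n)) meanD meanZ.
rewrite (mean_sum Q (fun i (s : 'S_n) => c (s i))).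
rewrite (eq_bigr (fun=> 0)) ?big1_eq ?mulr0 ?add0r ?lerD2l; last first.
  by move=> i _; rewrite mean_perm_point /mean c0 mulr0.
exact: mean_perm_sqr_centered.
Qed.

(** * Euclidean inner product and norm *)

Definition dot (R : realType) (d : nat) (u v : 'rV[R]_d) : R :=
  \sum_(i < d) u 0 i * v 0 i.

Lemma enorm_ge0 (R : realType) (d : nat) (v : 'rV[R]_d) : 0 <= enorm v.
Proof. exact: sqrtr_ge0. Qed.

Lemma sqr_enorm (R : realType) (d : nat) (v : 'rV[R]_d) :
  enorm v ^+ 2 = \sum_(i < d) v 0 i ^+ 2.
Proof. by rewrite sqr_sqrtr// sumr_ge0// => i _; rewrite sqr_ge0. Qed.

Lemma sqr_enormD (R : realType) (d : nat) (u v : 'rV[R]_d) :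
  enorm (u + v) ^+ 2 = enorm u ^+ 2 + 2 * dot u v + enorm v ^+ 2.
Proof.
rewrite !sqr_enorm mulr_sumr -!big_split/=; apply: eq_bigr => i _.
by rewrite mxE; ring.
Qed.

Lemma sqr_enormZ (R : realType) (d : nat) (a : R) (v : 'rV[R]_d) :
  enorm (a *: v) ^+ 2 = a ^+ 2 * enorm v ^+ 2.
Proof.
rewrite !sqr_enorm mulr_sumr; apply: eq_bigr => i _.
by rewrite mxE exprMn.
Qed.

Lemma dotZr (R : realType) (d : nat) (a : R) (u v : 'rV[R]_d) :
  dot u (a *: v) = a * dot u v.
Proof. by rewrite mulr_sumr; apply: eq_bigr => i _; rewrite mxE mulrCA. Qed.

Lemma dotBl (R : realType) (d : nat) (u v w : 'rV[R]_d) :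
  dot (u - v) w = dot u w - dot v w.
Proof. by rewrite -sumrB; apply: eq_bigr => i _; rewrite !mxE mulrBl. Qed.

Lemma sqr_enormB (R : realType) (d : nat) (u v : 'rV[R]_d) :
  enorm (u - v) ^+ 2 = enorm u ^+ 2 - 2 * dot u v + enorm v ^+ 2.
Proof.
by rewrite -scaleN1r sqr_enormD dotZr sqr_enormZ; ring.
Qed.

Lemma sqr_enormBC (R : realType) (d : nat) (u v : 'rV[R]_d) :
  enorm (u - v) ^+ 2 = enorm (v - u) ^+ 2.
Proof. by rewrite -opprB -scaleN1r sqr_enormZ sqrrN expr1n mul1r. Qed.

Lemma sqr_enormD_le (R : realType) (d : nat) (u v : 'rV[R]_d) :
  enorm (u + v) ^+ 2 <= 2 * enorm u ^+ 2 + 2 * enorm v ^+ 2.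
Proof.
have := sqr_ge0 (enorm (u - v)).
by rewrite sqr_enormB sqr_enormD; lra.
Qed.

(** The Cauchy-Schwarz inequality against the constant 1: twice the gap between the two sides is the
    double sum of the squares [(a i - a j) ^ 2]. *)
Lemma sqr_sum_le (R : realFieldType) (I : finType) (Q : pred I) (a : I -> R) :
  (\sum_(i | Q i) a i) ^+ 2 <= #|Q|%:R * \sum_(i | Q i) a i ^+ 2.
Proof.
have : 0 <= \sum_(i | Q i) \sum_(j | Q j) (a i - a j) ^+ 2.
  by apply: sumr_ge0 => i _; apply: sumr_ge0 => j _; exact: sqr_ge0.
have -> : \sum_(i | Q i) \sum_(j | Q j) (a i - a j) ^+ 2 =
    2 * (#|Q|%:R * \sum_(i | Q i) a i ^+ 2) - 2 * (\sum_(i | Q i) a i) ^+ 2.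
  transitivity (\sum_(i | Q i) (#|Q|%:R * a i ^+ 2 + \sum_(j | Q j) a j ^+ 2 -
      2 * (\sum_(j | Q j) a j) * a i)).
    apply: eq_bigr => i _; rewrite mulrAC mulr_sumr.
    have -> : #|Q|%:R * a i ^+ 2 = \sum_(j | Q j) a i ^+ 2.
      by rewrite sumr_const mulr_natl.
    by rewrite -big_split -sumrB/=; apply: eq_bigr => j _; ring.
  rewrite sumrB big_split/= -!mulr_sumr sumr_const.
  by rewrite -[_ *+ _]mulr_natl; ring.
by lra.
Qed.

Lemma sqr_enorm_sum_le (R : realType) (d : nat) (I : finType) (Q : pred I)
    (a : I -> 'rV[R]_d) :
  enorm (\sum_(i | Q i) a i) ^+ 2 <= #|Q|%:R * \sum_(i | Q i) enorm (a i) ^+ 2.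
Proof.
rewrite sqr_enorm (eq_bigr _ (fun i _ => sqr_enorm (a i))).
rewrite exchange_big mulr_sumr/=; apply: ler_sum => j _.
by rewrite summxE sqr_sum_le.
Qed.

(** The squared Euclidean norm is a sum over coordinates, so the scalar bound applies to each
    coordinate separately. *)
Lemma mean_perm_sqr_enorm (R : realType) (d n : nat) (a : 'I_n -> 'rV[R]_d)
    (Q : pred 'I_n) :
  (0 < n)%N ->
  mean R 'S_n (fun s => enorm (\sum_(i | Q i) a (s i)) ^+ 2) <=
  #|Q|%:R ^+ 2 * enorm (n%:R^-1 *: \sum_i a i) ^+ 2 +
  #|Q|%:R * mean R 'I_n (fun i => enorm (a i - n%:R^-1 *: \sum_i a i) ^+ 2).
Proof.
move=> n0.
have m j : (n%:R^-1 *: \sum_i a i) 0 j = mean R 'I_n (fun i => a i 0 j).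
  by rewrite mxE summxE /mean card_ord.
under eq_mean do rewrite sqr_enorm.
rewrite sqr_enorm (mean_sum xpredT).
under [in leRHS]eq_mean do rewrite sqr_enorm.
rewrite (mean_sum xpredT) !mulr_sumr -big_split/=; apply: ler_sum => j _.
under eq_mean do rewrite summxE.
apply: le_trans (mean_perm_sqr (fun i => a i 0 j) Q n0) _.
rewrite le_eqVlt; apply/orP; left; apply/eqP.
rewrite m; congr (_ + _ * _); apply: eq_mean => i.
by rewrite !mxE -m !mxE.
Qed.

(** * Drift of the inner iterates within one epoch *)

Definition rr_inner (R : realType) (d n : nat)
    (G : 'I_n -> 'rV[R]_d -> 'rV[R]_d) (gamma : R) (s : 'S_n) (x : 'rV[R]_d)
    (k : nat) : 'rV[R]_d :=
  foldl (fun y i => y - gamma *: G (s i) y) x (take k (enum 'I_n)).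

Lemma rr_innerS (R : realType) (d n : nat) (G : 'I_n -> 'rV[R]_d -> 'rV[R]_d)
    (gamma : R) (s : 'S_n) (x : 'rV[R]_d) (i : 'I_n) :
  rr_inner G gamma s x i.+1 =
  rr_inner G gamma s x i - gamma *: G (s i) (rr_inner G gamma s x i).
Proof.
rewrite /rr_inner (take_nth i) ?size_enum_ord// nth_ord_enum.
by rewrite foldl_rcons.
Qed.

Lemma rr_inner_sub (R : realType) (d n : nat)
    (G : 'I_n -> 'rV[R]_d -> 'rV[R]_d) (gamma : R) (s : 'S_n) (x : 'rV[R]_d)
    (k : nat) : (k <= n)%N ->
  rr_inner G gamma s x k - x =
  - gamma *: \sum_(i < n | (i < k)%N) G (s i) (rr_inner G gamma s x i).
Proof.
elim: k => [|k IH] kn.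
  by rewrite /rr_inner take0/= subrr big_pred0 ?scaler0.
rewrite (rr_innerS G gamma s x (Ordinal kn))/=.
rewrite (bigD1 (Ordinal kn))//= scalerDr addrAC IH ?(ltnW kn)// -scaleNr addrC.
congr (_ + _ *: _); apply: eq_bigl => i.
by rewrite -val_eqE/= ltnS ltn_neqAle andbC.
Qed.

Lemma card_ord_ltn (n k : nat) : (k <= n)%N ->
  #|(fun i : 'I_n => (i < k)%N)| = k.
Proof.
move=> kn; rewrite -sum1_card.
by rewrite -(big_ord_widen n (fun=> 1%N) kn) sum1_card card_ord.
Qed.

Lemma sum_ord_le (R : realFieldType) (n : nat) :
  2 * \sum_(k < n) (k%:R : R) <= n%:R ^+ 2.
Proof.
elim: n => [|n IH]; first by rewrite big_ord0 mulr0 sqr_ge0.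
by rewrite big_ord_recr/= -(natr1 n); lra.
Qed.

Lemma sum_sqr_ord_le (R : realFieldType) (n : nat) :
  3 * \sum_(k < n) (k%:R : R) ^+ 2 <= n%:R ^+ 3.
Proof.
elim: n => [|n IH]; first by rewrite big_ord0 mulr0 exprn_ge0.
rewrite big_ord_recr/= -(natr1 n).
have -> : ((n%:R : R) + 1) ^+ 3 = n%:R ^+ 3 + 3 * n%:R ^+ 2 + 3 * n%:R + 1.
  by ring.
have : 0 <= (n%:R : R) by [].
by lra.
Qed.

(** A self-bounding argument: replacing the gradients along the epoch by those at [x] costs an error
    controlled by the total drift [V] itself, and the stepsize is small enough to absorb that
    error. *)
Lemma rr_inner_drift (R : realType) (d n : nat)
    (G : 'I_n -> 'rV[R]_d -> 'rV[R]_d) (L gamma : R) (s : 'S_n)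
    (x : 'rV[R]_d) :
  (forall i y, enorm (G i y - G i x) ^+ 2 <= L ^+ 2 * enorm (y - x) ^+ 2) ->
  0 <= gamma -> 0 <= L -> 2 * L * n%:R * gamma <= 1 ->
  \sum_(k < n) enorm (rr_inner G gamma s x k - x) ^+ 2 <=
  8 / 3 * gamma ^+ 2 *
    \sum_(k < n) enorm (\sum_(i < n | (i < k)%N) G (s i) x) ^+ 2.
Proof.
move=> GL g0 L0 gL; set V := \sum_(k < n) _; set S := \sum_(k < n) _.
have V0 : 0 <= V by apply: sumr_ge0 => k _; exact: sqr_ge0.
have step (k : 'I_n) : enorm (rr_inner G gamma s x k - x) ^+ 2 <=
   k%:R * (2 * gamma ^+ 2 * L ^+ 2 * V) +
   2 * gamma ^+ 2 * enorm (\sum_(i < n | (i < k)%N) G (s i) x) ^+ 2.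
  rewrite rr_inner_sub ?(ltnW (ltn_ord k))// sqr_enormZ sqrrN.
  set Y := \sum_(i < n | _) G (s i) (rr_inner _ _ _ _ _).
  have -> : Y = \sum_(i < n | (i < k)%N)
      (G (s i) (rr_inner G gamma s x i) - G (s i) x) +
      \sum_(i < n | (i < k)%N) G (s i) x.
    by rewrite sumrB subrK.
  have dG : enorm (\sum_(i < n | (i < k)%N)
      (G (s i) (rr_inner G gamma s x i) - G (s i) x)) ^+ 2 <=
      k%:R * (L ^+ 2 * V).
    apply: le_trans (sqr_enorm_sum_le _ _) _.
    rewrite card_ord_ltn ?(ltnW (ltn_ord k))//; apply: ler_wpM2l => //.
    rewrite mulr_sumr big_mkcond/=; apply: ler_sum => i _.
    by case: ifP => // _; rewrite mulr_ge0 ?sqr_ge0.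
  apply: le_trans (ler_wpM2l (sqr_ge0 _) (sqr_enormD_le _ _)) _.
  have := ler_wpM2l (sqr_ge0 gamma) dG.
  by lra.
have VS : V <= gamma ^+ 2 * L ^+ 2 * n%:R ^+ 2 * V + 2 * gamma ^+ 2 * S.
  apply: le_trans (ler_sum _ (fun k _ => step k)) _.
  rewrite big_split/= -mulr_sumr lerD2r -mulr_suml.
  (* The sum of [k] over [k < n] is at most [n ^ 2 / 2], which cancels the factor 2 in [step]. *)
  have := ler_wpM2r (mulr_ge0 (mulr_ge0 (sqr_ge0 gamma) (sqr_ge0 L)) V0)
    (sum_ord_le R n).
  by lra.
(* Hence [gamma ^ 2 L ^ 2 n ^ 2 <= 1 / 4], so [VS] yields [3 / 4 V <= 2 gamma ^ 2 S], whence the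
   constant [8 / 3]. *)
have : (2 * L * n%:R * gamma) ^+ 2 <= 1 ^+ 2.
  by rewrite lerXn2r ?nnegrE// !mulr_ge0.
move=> /(ler_wpM2r V0).
by lra.
Qed.

(** The partial sum of [k] frozen gradients has second moment at most [k ^ 2 m + k v]; summing over
    [k < n] gives [n ^ 3 / 3] and [n ^ 2 / 2], and multiplying by [8 / 3] gives [8 / 9] and
    [4 / 3]. *)
Lemma mean_rr_inner_drift (R : realType) (d n : nat)
    (G : 'I_n -> 'rV[R]_d -> 'rV[R]_d) (L gamma : R) (x : 'rV[R]_d) :
  (0 < n)%N ->
  (forall i y, enorm (G i y - G i x) ^+ 2 <= L ^+ 2 * enorm (y - x) ^+ 2) ->
  0 <= gamma -> 0 <= L -> 2 * L * n%:R * gamma <= 1 ->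
  mean R 'S_n
    (fun s => \sum_(k < n) enorm (rr_inner G gamma s x k - x) ^+ 2) <=
  8 / 9 * gamma ^+ 2 * n%:R ^+ 3 * enorm (n%:R^-1 *: \sum_i G i x) ^+ 2 +
  4 / 3 * gamma ^+ 2 * n%:R ^+ 2 *
    mean R 'I_n (fun i => enorm (G i x - n%:R^-1 *: \sum_i G i x) ^+ 2).
Proof.
move=> n0 GL g0 L0 gL.
apply: le_trans (ler_mean (fun s => rr_inner_drift s GL g0 L0 gL)) _.
rewrite meanZ (mean_sum xpredT (fun (k : 'I_n) (s : 'S_n) =>
  enorm (\sum_(i < n | (i < k)%N) G (s i) x) ^+ 2)).
set m := enorm (n%:R^-1 *: _) ^+ 2; set v := mean R 'I_n _.
have m0 : 0 <= m by exact: sqr_ge0.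
have v0 : 0 <= v by apply: mean_ge0 => i; exact: sqr_ge0.
have H : \sum_(k < n) mean R 'S_n
      (fun s : 'S_n => enorm (\sum_(i < n | (i < k)%N) G (s i) x) ^+ 2) <=
    (\sum_(k < n) k%:R ^+ 2) * m + (\sum_(k < n) k%:R) * v.
  rewrite !mulr_suml -big_split/=; apply: ler_sum => k _.
  have := mean_perm_sqr_enorm (fun i => G i x) (fun i => (i < k)%N) n0.
  by rewrite card_ord_ltn ?(ltnW (ltn_ord k)).
have := ler_wpM2l (sqr_ge0 gamma) H.
have := ler_wpM2l (sqr_ge0 gamma) (ler_wpM2r m0 (sum_sqr_ord_le R n)).
have := ler_wpM2l (sqr_ge0 gamma) (ler_wpM2r v0 (sum_ord_le R n)).
by lra.
Qed.

(** * Smooth functions: the descent inequality and the gradient of an average *)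

Lemma sqr_smooth (R : realType) (d : nat) (L : R) (g : 'rV[R]_d -> R)
    (x y : 'rV[R]_d) :
  smooth L g -> 0 <= L ->
  enorm (gradient g x - gradient g y) ^+ 2 <= L ^+ 2 * enorm (x - y) ^+ 2.
Proof.
by move=> gL L0; rewrite -exprMn lerXn2r ?nnegrE ?mulr_ge0 ?enorm_ge0.
Qed.

Lemma derive_dot_gradient (R : realType) (d : nat) (g : 'rV[R]_d -> R)
    (x v : 'rV[R]_d) :
  differentiable g x -> 'D_v g x = dot (gradient g x) v.
Proof.
move=> dg; rewrite deriveE// {1}(row_sum_delta v) linear_sum.
apply: eq_bigr => i _; rewrite linearZ/= mxE deriveE//.
by rewrite mulrC.
Qed.

Lemma is_derive_line (R : realType) (d : nat) (g : 'rV[R]_d -> R)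
    (x v : 'rV[R]_d) (t : R) :
  (forall y, differentiable g y) ->
  is_derive t 1 (fun t => g (x + t *: v)) (dot (gradient g (x + t *: v)) v).
Proof.
move=> dg.
(* The difference quotient along the line at [t] is the quotient of [g] at [x + t v] in direction
   [v], so no chain rule is needed. *)
have E : (fun h : R => h^-1 *: (((fun t => g (x + t *: v)) \o shift t) (h *: 1) -
      g (x + t *: v))) =
    (fun h : R => h^-1 *: ((g \o shift (x + t *: v)) (h *: v) - g (x + t *: v))).
  apply/funext => h /=; congr (_ *: (g _ - _)).
  by rewrite [h%:A]mulr1 scalerDl addrCA addrA.
apply: DeriveDef; first by rewrite /derivable E; exact: diff_derivable.
by rewrite /derive E -derive_dot_gradient.
Qed.

(* The difference between the two sides is nonincreasing along the segment from
   [x] to [x + v], by Young's inequality and the Lipschitz bound on the gradient. *)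
Lemma smooth_descent (R : realType) (d : nat) (L : R) (g : 'rV[R]_d -> R)
    (x v : 'rV[R]_d) :
  (forall y, differentiable g y) -> smooth L g -> 0 < L ->
  g (x + v) <= g x + dot (gradient g x) v + L / 2 * enorm v ^+ 2.
Proof.
move=> dg gL L0.
pose h (t : R) := g (x + t *: v) - t * dot (gradient g x) v -
  t ^+ 2 * (L / 2 * enorm v ^+ 2).
pose dh (t : R) := dot (gradient g (x + t *: v)) v -
  dot (gradient g x) v - t * (L * enorm v ^+ 2).
have hder (t : R) : is_derive t 1 h (dh t).
  have := is_derive_line x v t dg => ?.
  apply: is_derive_eq.
  rewrite /dh /GRing.scale/=; lra.
have hle t : 0 < t -> dh t <= 0.
  move=> t0; have Lt0 : 0 < L * t by rewrite mulr_gt0.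
  rewrite -(pmulr_rle0 _ Lt0) /dh -dotBl.
  have := sqr_smooth (x + t *: v) x gL (ltW L0).
  rewrite [x + _ - x]addrAC subrr add0r sqr_enormZ.
  (* Young's inequality with weight [L t], chosen to balance the Lipschitz bound: with [u] the
     gradient difference, [2 L t <u, v> <= |u| ^ 2 + L ^ 2 t ^ 2 |v| ^ 2], where
     [|u| ^ 2 <= L ^ 2 t ^ 2 |v| ^ 2]. *)
  have := sqr_ge0 (enorm ((gradient g (x + t *: v) - gradient g x) - (L * t) *: v)).
  rewrite (sqr_enormB (_ - _)) dotZr sqr_enormZ.
  by lra.
have h10 : h 1 <= h 0.
  apply: (@ler0_derive1_le_cc R h 0 1) => //; rewrite ?in_itv/= ?lexx ?ler01//.
  - by move=> t; rewrite in_itv/= => /andP[t0 _]; rewrite derive1E derive_val hle.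
  - apply: continuous_subspaceT => t; apply: differentiable_continuous.
    exact/derivable1_diffP.
move: h10; rewrite /h scale1r scale0r addr0; lra.
Qed.

Lemma averageE (R : realType) (d n : nat) (f : 'I_n -> 'rV[R]_d -> R) :
  average f = n%:R^-1 *: (\sum_(i < n) f i).
Proof. by apply/funext => x; rewrite /average [RHS]/(_ *: _)/= fct_sumE. Qed.

Lemma differentiable_average (R : realType) (d n : nat)
    (f : 'I_n -> 'rV[R]_d -> R) (x : 'rV[R]_d) :
  (forall i, differentiable (f i) x) -> differentiable (average f) x.
Proof.
by move=> df; rewrite averageE; apply: differentiableZ; exact: differentiable_sum.
Qed.

Lemma gradient_average (R : realType) (d n : nat)
    (f : 'I_n -> 'rV[R]_d -> R) (x : 'rV[R]_d) :
  (forall i, differentiable (f i) x) ->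
  gradient (average f) x = n%:R^-1 *: \sum_(i < n) gradient (f i) x.
Proof.
move=> df; apply/rowP => j; rewrite !mxE summxE averageE.
have dfj i : derivable (f i) x (delta_mx 0 j) by exact: diff_derivable.
rewrite deriveZ ?derive_sum//; last exact: derivable_sum.
by congr (_ * _); apply: eq_bigr => i _; rewrite mxE.
Qed.

(** * Expected decrease over one epoch *)

Section epoch.
Context (R : realType) (d n : nat) (f : 'I_n -> 'rV[R]_d -> R).
Context (L gamma : R) (x : 'rV[R]_d).
Hypothesis n0 : (0 < n)%N.
Hypothesis df : forall i y, differentiable (f i) y.
Hypothesis L0 : 0 < L.
Hypothesis fL : smooth L (average f).
Hypothesis fiL : forall i, smooth L (f i).
Hypothesis g0 : 0 < gamma.
Hypothesis gL : 2 * L * n%:R * gamma <= 1.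

Let G i := gradient (f i).
Let m := gradient (average f) x.

(** The epoch is a step [- gamma n g], where [g] averages the gradients met along the way.
    Polarization turns [- <m, g>] into half of [|m - g| ^ 2 - |m| ^ 2 - |g| ^ 2], and smoothness
    bounds [|m - g| ^ 2] by the drift. *)
Lemma rr_epoch_descent (s : 'S_n) :
  average f (rr_epoch f gamma s x) <=
  average f x - gamma * n%:R / 2 * enorm m ^+ 2 +
  gamma * L ^+ 2 / 2 *
    \sum_(k < n) enorm (rr_inner G gamma s x k - x) ^+ 2.
Proof.
have nR0 : (0 : R) < n%:R by rewrite ltr0n.
set V := \sum_(k < n) _.
pose g := n%:R^-1 *: \sum_(i < n) G (s i) (rr_inner G gamma s x i).
have -> : rr_epoch f gamma s x = x + (- (gamma * n%:R)) *: g.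
  have -> : rr_epoch f gamma s x = rr_inner G gamma s x n.
    by rewrite /rr_inner take_oversize ?size_enum_ord.
  have /(canRL (subrK x)) -> := rr_inner_sub G gamma s x (leqnn n).
  rewrite (eq_bigl xpredT); last by move=> i; rewrite ltn_ord.
  rewrite /g scalerA addrC; congr (_ + _ *: _).
  by rewrite mulNr mulfK// lt0r_neq0.
have := smooth_descent x (- (gamma * n%:R) *: g)
  (fun y => differentiable_average (df^~ y)) fL L0.
rewrite dotZr sqr_enormZ sqrrN -/m.
have mg : n%:R * enorm (m - g) ^+ 2 <= L ^+ 2 * V.
  (* Reordering the full gradient by [s] pairs each summand with the gradient of the same component
     in [g]. *)
  rewrite /m gradient_average// (reindex_inj (@perm_inj _ s))/=.
  rewrite -scalerBr -sumrB sqr_enormZ.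
  rewrite -(ler_pM2l nR0).
  have -> (e : R) : n%:R * (n%:R * (n%:R^-1 ^+ 2 * e)) = e.
    by field; rewrite lt0r_neq0.
  apply: le_trans (sqr_enorm_sum_le _ _) _.
  rewrite cardT size_enum_ord ler_wpM2l// mulr_sumr; apply: ler_sum => i _.
  rewrite [X in _ * X]sqr_enormBC.
  by apply: sqr_smooth; [exact: fiL | exact: ltW].
move=> H; apply: le_trans H _.
have := ler_wpM2l (ltW g0) mg.
rewrite sqr_enormB.
(* The quadratic term of the descent inequality is absorbed by [- gamma n / 2 |g| ^ 2], because
   [L n gamma <= 1]. *)
have : 0 <= gamma * n%:R * (1 - L * n%:R * gamma) * enorm g ^+ 2.
  rewrite mulr_ge0 ?sqr_ge0// mulr_ge0//; first by rewrite mulr_ge0 ?ltW.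
  have : 0 < L * n%:R * gamma by rewrite !mulr_gt0.
  by move: gL; lra.
lra.
Qed.

Lemma mean_rr_epoch_descent (A B fstar : R) :
  n%:R^-1 * \sum_(i < n) enorm (G i x - m) ^+ 2 <=
    2 * A * (average f x - fstar) + B ^+ 2 ->
  mean R 'S_n (fun s => average f (rr_epoch f gamma s x)) <=
  average f x - 7 / 18 * gamma * n%:R * enorm m ^+ 2 +
  2 / 3 * gamma ^+ 3 * L ^+ 2 * n%:R ^+ 2 *
    (2 * A * (average f x - fstar) + B ^+ 2).
Proof.
move=> hvar; have nR0 : (0 : R) < n%:R by rewrite ltr0n.
apply: le_trans (ler_mean rr_epoch_descent) _.
rewrite meanD meanZ (mean_cst _ (card_perm_gt0 n)).
have GL i y : enorm (G i y - G i x) ^+ 2 <= L ^+ 2 * enorm (y - x) ^+ 2.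
  by apply: sqr_smooth; [exact: fiL | exact: ltW].
have := mean_rr_inner_drift n0 GL (ltW g0) (ltW L0) gL.
rewrite -(gradient_average (df^~ x)) -/m.
set D := mean R 'S_n _ => HD.
have hv : mean R 'I_n (fun i => enorm (G i x - m) ^+ 2) <=
    2 * A * (average f x - fstar) + B ^+ 2 by rewrite /mean card_ord.
set v := mean R 'I_n _ in HD hv.
set w := 2 * A * _ + _ in hv *.
have c0 : 0 <= gamma ^+ 3 * L ^+ 2 * n%:R ^+ 2.
  by rewrite !mulr_ge0 ?exprn_ge0 ?ltW.
have hc := ler_wpM2l c0 hv.
have c1 : 0 <= gamma * L ^+ 2 / 2.
  by rewrite divr_ge0// mulr_ge0 ?sqr_ge0 ?ltW.
have hD := ler_wpM2l c1 HD.
(* The drift contributes [4 / 9 gamma ^ 3 L ^ 2 n ^ 3 |m| ^ 2], which is at most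
   [gamma n |m| ^ 2 / 9]; the remaining coefficient is [1 / 2 - 1 / 9 = 7 / 18]. *)
have hm : (2 * L * n%:R * gamma) ^+ 2 <= 1 ^+ 2.
  by rewrite lerXn2r ?nnegrE// !mulr_ge0 ?ltW.
have c2 : 0 <= gamma * n%:R * enorm m ^+ 2.
  by rewrite mulr_ge0 ?sqr_ge0// mulr_ge0 ?ltW.
have := ler_wpM2r c2 hm.
by lra.
Qed.

End epoch.

(** * Averages over tuples of permutations *)

Lemma rr_iterate_ext (R : realType) (d n : nat) (f : 'I_n -> 'rV[R]_d -> R)
    (gamma : R) (x0 : 'rV[R]_d) (p q : nat -> 'S_n) (t : nat) :
  (forall k, (k < t)%N -> p k = q k) ->
  rr_iterate f gamma x0 p t = rr_iterate f gamma x0 q t.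
Proof.
elim: t => //= t IH pq; rewrite pq// IH// => k kt.
by rewrite pq// ltnW.
Qed.

(* The value [1%g] beyond [T] is never used by the first [T] epochs. *)
Definition extend_perms (n T : nat) (s : {ffun 'I_T -> 'S_n}) (k : nat) : 'S_n :=
  if insub k is Some i then s i else 1%g.

Lemma extend_permsE (n T : nat) (s : {ffun 'I_T -> 'S_n}) (i : 'I_T) :
  extend_perms s i = s i.
Proof. by rewrite /extend_perms valK. Qed.

Lemma card_ffun_perm_gt0 (n T : nat) : (0 < #|{ffun 'I_T -> 'S_n}|)%N.
Proof. by apply/card_gt0P; exists [ffun=> 1%g]. Qed.

(* Right multiplication of [s t] by a permutation preserves the uniform
   distribution and [X s]; average over all permutations. *)
Lemma mean_ffun_coordinate (R : realFieldType) (n T : nat) (Y : Type)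
    (X : {ffun 'I_T -> 'S_n} -> Y) (h : Y -> 'S_n -> R) (t : 'I_T) :
  (forall s s' : {ffun 'I_T -> 'S_n},
    (forall i, i != t -> s i = s' i) -> X s = X s') ->
  mean R {ffun 'I_T -> 'S_n} (fun s => h (X s) (s t)) =
  mean R {ffun 'I_T -> 'S_n} (fun s => mean R 'S_n (h (X s))).
Proof.
move=> Xt.
pose sh (tau : 'S_n) (s : {ffun 'I_T -> 'S_n}) : {ffun 'I_T -> 'S_n} :=
  [ffun i => if i == t then (s i * tau)%g else s i].
have shI tau : injective (sh tau).
  move=> s s' /ffunP e; apply/ffunP => i; move: (e i); rewrite !ffunE.
  by case: ifP => // _ /mulIg.
have shX tau s : X (sh tau s) = X s.
  by apply: Xt => i it; rewrite ffunE (negbTE it).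
transitivity (mean R 'S_n (fun tau => mean R {ffun 'I_T -> 'S_n}
    (fun s => h (X s) (s t * tau)%g))).
  rewrite -[LHS](@mean_cst R 'S_n _ (card_perm_gt0 n)); apply: eq_mean => tau.
  rewrite -(mean_shift (fun s => h (X s) (s t)) (shI tau)).
  by apply: eq_mean => s; rewrite shX ffunE eqxx.
rewrite exchange_mean; apply: eq_mean => s.
exact: (mean_shift _ (mulgI (s t))).
Qed.

Section finite_run.
Context (R : realType) (d n : nat) (f : 'I_n -> 'rV[R]_d -> R).
Context (L A B fstar gamma : R) (x0 : 'rV[R]_d) (T : nat).
Hypothesis n0 : (0 < n)%N.
Hypothesis df : forall i y, differentiable (f i) y.
Hypothesis L0 : 0 < L.
Hypothesis fL : smooth L (average f).
Hypothesis fiL : forall i, smooth L (f i).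
Hypothesis g0 : 0 < gamma.
Hypothesis gL : 2 * L * n%:R * gamma <= 1.
Hypothesis hvar : forall x,
  n%:R^-1 * \sum_(i < n)
    enorm (gradient (f i) x - gradient (average f) x) ^+ 2
  <= 2 * A * (average f x - fstar) + B ^+ 2.

Definition mean_run (h : 'rV[R]_d -> R) (t : nat) : R :=
  mean R {ffun 'I_T -> 'S_n}
    (fun s => h (rr_iterate f gamma x0 (extend_perms s) t)).

Let a := 4 / 3 * gamma ^+ 3 * L ^+ 2 * n%:R ^+ 2 * A.
Let b := 2 / 3 * gamma ^+ 3 * L ^+ 2 * n%:R ^+ 2 * B ^+ 2.

(** The iterate at time [t] depends only on the permutations before [t], so the one at [t] can be
    averaged out first with that iterate fixed, which is the one-epoch estimate. *)
Lemma mean_run_descent (t : nat) : (t < T)%N ->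
  mean_run (average f) t.+1 - fstar <=
  (1 + a) * (mean_run (average f) t - fstar) -
  7 / 18 * gamma * n%:R *
    mean_run (fun x => enorm (gradient (average f) x) ^+ 2) t + b.
Proof.
move=> tT; pose X (s : {ffun 'I_T -> 'S_n}) :=
  rr_iterate f gamma x0 (extend_perms s) t.
have -> : mean_run (average f) t.+1 = mean R {ffun 'I_T -> 'S_n}
    (fun s => mean R 'S_n (fun tau => average f (rr_epoch f gamma tau (X s)))).
  rewrite -(@mean_ffun_coordinate R n T _ X
    (fun x tau => average f (rr_epoch f gamma tau x)) (Ordinal tT)).
    by apply: eq_mean => s /=; rewrite (extend_permsE s (Ordinal tT)).
  move=> s s' ss'; apply: rr_iterate_ext => k kt.
  have kT := ltn_trans kt tT.
  rewrite -[k]/(val (Ordinal kT)) !extend_permsE ss'//.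
  by rewrite -val_eqE/= neq_ltn kt.
have H s := mean_rr_epoch_descent n0 df L0 fL fiL g0 gL (hvar (X s)).
rewrite lerBlDr; apply: le_trans (ler_mean H) _.
have affine (p q e : R) (u v : {ffun 'I_T -> 'S_n} -> R) :
    mean R {ffun 'I_T -> 'S_n} (fun s => p * u s + (q * v s + e)) =
    p * mean R {ffun 'I_T -> 'S_n} u + (q * mean R {ffun 'I_T -> 'S_n} v + e).
  by rewrite !meanD !meanZ mean_cst ?card_ffun_perm_gt0.
rewrite (@eq_mean _ _ _ (fun s => (1 + a) * average f (X s) +
   (- (7 / 18 * gamma * n%:R) * enorm (gradient (average f) (X s)) ^+ 2 +
   (b - a * fstar)))); last by move=> s; rewrite /a /b; lra.
rewrite affine.
rewrite -/(mean_run (average f) t).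
rewrite -/(mean_run (fun x => enorm (gradient (average f) x) ^+ 2) t).
by lra.
Qed.

End finite_run.

(** * Solving the descent recursion *)

Lemma expR_43_le (R : realType) : expR (4 / 3 : R) <= 81 / 16.
Proof.
(* Use [1 + x <= expR x] at [x = - 1 / 3]; the fourth power then gives
   [expR (4 / 3) <= (3 / 2) ^ 4 = 81 / 16]. *)
have h : 2 / 3 <= expR (- (1 / 3) : R).
  by apply: le_trans (expR_ge1Dx _); lra.
have h4 : (2 / 3 : R) ^+ 4 <= expR (- (4 / 3)).
  have -> : - (4 / 3) = 4%:R * - (1 / 3) :> R by lra.
  by rewrite expRM_natl lerXn2r ?nnegrE ?expR_ge0//; lra.
have e0 := expR_gt0 (4 / 3 : R).
have : expR (4 / 3 : R) * (2 / 3) ^+ 4 <= 1.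
  by rewrite -[leRHS](expRxMexpNx_1 (4 / 3)) ler_pM2l.
lra.
Qed.

Lemma exp_growth_le (R : realType) (a : R) (T : nat) :
  0 <= a -> a * T%:R <= 4 / 3 -> (1 + a) ^+ T <= 81 / 16.
Proof.
move=> a0 aT; apply: le_trans (expR_43_le R).
apply: (@le_trans _ _ (expR a ^+ T)).
  by rewrite lerXn2r ?nnegrE ?expR_ge0 ?expR_ge1Dx// addr_ge0.
by rewrite -expRM_natl ler_expR mulrC.
Qed.

(** If every [r t] exceeded [e], each step would subtract more than [c e - b]. Unrolling over [T]
    steps, with [(1 + a) ^ T <= 81 / 16], would make [dl T] negative. *)
Lemma descent_exists_small (R : realType) (a c b e : R) (dl r : nat -> R)
    (T : nat) :
  0 <= a -> a * T%:R <= 4 / 3 -> 0 < c -> b <= c * e -> (0 < T)%N ->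
  (forall t, 0 <= dl t) ->
  (forall t, (t < T)%N -> dl t.+1 <= (1 + a) * dl t - c * r t + b) ->
  81 / 16 * dl 0%N <= (c * e - b) * T%:R ->
  exists2 t, (t < T)%N & r t <= e.
Proof.
move=> a0 aT c0 bce T0 dl0 rec hT; apply: contrapT => nex.
have re t : (t < T)%N -> e < r t.
  by move=> tT; rewrite ltNge; apply/negP => rt; apply: nex; exists t.
(* Stated at [t.+1] because the inequality is strict, whereas at index 0 both sides coincide. *)
have key t : (t < T)%N ->
    dl t.+1 < (1 + a) ^+ t.+1 * dl 0%N - (c * e - b) * t.+1%:R.
  elim: t => [|t IH] tT.
    have := rec 0%N tT; have := re 0%N tT; rewrite -(ltr_pM2l c0) expr1 mulr1.
    by lra.
  have := IH (ltnW tT); have := rec _ tT; have := re _ tT.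
  rewrite -(ltr_pM2l c0) => h1 h2 h3.
  have a1 : 0 < 1 + a by rewrite ltr_pwDl.
  move: h3; rewrite -(ltr_pM2l a1) mulrBr mulrA -exprS => h3.
  have : 0 <= a * ((c * e - b) * t.+1%:R).
    by rewrite mulr_ge0// mulr_ge0// subr_ge0.
  rewrite -[t.+2%:R]natr1; lra.
case: T T0 aT rec hT nex re key => // T _ aT rec hT nex re /(_ T (ltnSn _)).
have := exp_growth_le a0 aT => /(ler_wpM2r (dl0 0%N)).
have := dl0 T.+1; lra.
Qed.

(** * The law of the random run: expectations as finite averages *)

Lemma expectation_perm_run (R : realType) (n T : nat) (dO : measure_display)
    (Omega : measurableType dO) (P : probability Omega R)
    (pi : nat -> Omega -> 'S_n) (h : {ffun 'I_T -> 'S_n} -> R) :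
  (forall t, (t < T)%N -> discrete_rv (pi t)) ->
  (forall t, (t < T)%N -> uniform_rv P (pi t)) ->
  mutually_independent P (fun t : 'I_T => pi t) ->
  (forall s, 0 <= h s) ->
  ('E_P[fun w => h [ffun t : 'I_T => pi t w]])%E =
  (mean R {ffun 'I_T -> 'S_n} h)%:E.
Proof.
move=> pim piu pii h0.
pose D (s : {ffun 'I_T -> 'S_n}) : set Omega :=
  \bigcap_(t in [set` [set: 'I_T]%SET]) (pi t @^-1` [set s t]).
have mD s : measurable (D s).
  apply: fin_bigcap_measurable => //= t _; exact: pim.
(* Independence and uniformity make all tuples [s] equally likely. *)
have PD s : P (D s) = ((#|{ffun 'I_T -> 'S_n}|%:R)^-1)%:E.
  rewrite /D (pii _ (fun t => [set s t])).
  rewrite (eq_bigr (fun=> ((#|{perm 'I_n}|%:R)^-1)%:E)); last first.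
    by move=> t _; rewrite (piu t (ltn_ord t)).
  rewrite (eq_bigl xpredT) => [|t]; last by rewrite inE.
  rewrite prodEFin prodr_const card_ord card_ffun card_ord.
  by rewrite natrX exprVn.
(* The events [D s] partition [Omega], so the integrand is a finite combination of their
   indicators. *)
have hE w : (h [ffun t : 'I_T => pi t w])%:E =
    (\sum_(s : {ffun 'I_T -> 'S_n}) (h s)%:E * (\1_(D s) w)%:E)%E.
  rewrite (bigD1 [ffun t : 'I_T => pi t w])//= big1 ?adde0.
    rewrite indicE mem_set ?mule1// => t _ /=.
    by rewrite ffunE.
  move=> s sw; rewrite indicE memNset ?mule0// => Dw.
  move/eqP: sw; apply; apply/ffunP => t; rewrite ffunE.
  by rewrite (Dw t)//= inE.
rewrite unlock.
under eq_integral do rewrite hE.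
rewrite ge0_integral_sum//=; last 2 first.
- move=> s; apply/measurable_realfun.measurable_EFinP.
  exact: measurable_realfun.measurable_funM.
- by move=> s w _; rewrite lee_fin mulr_ge0.
rewrite /mean mulr_sumr -sumEFin; apply: eq_bigr => s _.
rewrite ge0_integralZl_EFin//=.
- rewrite integral_indic// setIT mulrC EFinM; congr (_ * _)%E.
  exact: PD.
- exact/measurable_realfun.measurable_EFinP.
Qed.

(** * The stepsize and the iteration budget *)

Lemma le_EFin_div (R : realType) (gamma e D : R) :
  0 <= D -> 0 < e -> (gamma%:E <= e%:E / D%:E)%E -> gamma * D <= e.
Proof.
rewrite le_eqVlt => /predU1P[<- e0 _|D0 e0]; first by rewrite mulr0 ltW.
by rewrite inver (gt_eqF D0) -EFinM lee_fin ler_pdivlMr.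
Qed.

(** The case [D = 0] is contradictory: the quotient would be [+oo], while [gamma] is finite. *)
Lemma eq_EFin_div (R : realType) (gamma e D : R) :
  0 <= D -> 0 < e -> (gamma%:E = e%:E / D%:E)%E -> gamma * D = e.
Proof.
rewrite le_eqVlt => /predU1P[<- e0|D0 e0].
  by rewrite inver eqxx gt0_muley.
rewrite inver (gt_eqF D0) -EFinM => -[->].
by rewrite divfK ?lt0r_neq0.
Qed.

Lemma powR_third (R : realType) (x : R) (k : nat) :
  0 <= x -> (x `^ (k%:R / 3)) ^+ 3 = x ^+ k.
Proof.
by move=> x0; rewrite -powR_mulrn ?powR_ge0// -powRrM divfK ?powR_mulrn//.
Qed.

(** Converts the extended-real minimum into polynomial facts, the cube clearing the fractional
    exponents. Besides the upper bounds, the minimum is attained by one of its terms; this is what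
    later bounds [gamma] from below. *)
Lemma rr_stepsizeP (R : realType) (L A B eps gamma : R) (n T : nat) :
  0 < L -> (0 < n)%N -> (0 < T)%N -> 0 <= A -> 0 <= B -> 0 < eps ->
  gamma%:E = rr_stepsize L A B eps n T ->
  [/\ 0 < gamma, 2 * L * n%:R * gamma <= 1,
      gamma ^+ 3 * (A * L ^+ 2 * n%:R ^+ 2 * T%:R) <= 1,
      gamma * (2 * L * Num.sqrt n%:R * B) <= eps &
      [\/ gamma * (2 * L * n%:R) = 1,
          gamma ^+ 3 * (A * L ^+ 2 * n%:R ^+ 2 * T%:R) = 1 |
          gamma * (2 * L * Num.sqrt n%:R * B) = eps]].
Proof.
move=> L0 n0 T0 A0 B0 e0; rewrite /rr_stepsize.
have nR0 : (0 : R) < n%:R by rewrite ltr0n.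
set D1 := 2 * L * n%:R; set D3 := 2 * L * _ * B; set D2 := _ * _ `^ _.
have D10 : 0 < D1 by rewrite !mulr_gt0.
have D20 : 0 <= D2 by rewrite !mulr_ge0 ?powR_ge0.
have D30 : 0 <= D3 by rewrite !mulr_ge0 ?sqrtr_ge0// ltW.
have D2E : D2 ^+ 3 = A * L ^+ 2 * n%:R ^+ 2 * T%:R.
  rewrite /D2 3!exprMn (powR_third 1 A0) (powR_third 2 (ltW L0)).
  by rewrite (powR_third 2 (ltW nR0)) (powR_third 1 (ler0n R T)) !expr1.
have -> : (D1^-1)%:E = (1 / D1%:E)%E by rewrite inver gt_eqF// mul1e.
rewrite -[(D2%:E^-1)%E]mul1e => hg.
have g1 : gamma * D1 <= 1.
  by apply: le_EFin_div => //; [exact: ltW|rewrite hg ge_min lexx].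
have g2 : gamma * D2 <= 1.
  by apply: le_EFin_div => //; rewrite hg !ge_min lexx orbT.
have g3 : gamma * D3 <= eps.
  by apply: le_EFin_div => //; rewrite hg !ge_min lexx !orbT.
have hc : [\/ gamma * D1 = 1, gamma * D2 = 1 | gamma * D3 = eps].
  move: hg; rewrite /Order.min; case: ifP => _; last case: ifP => _.
  - by move=> /eq_EFin_div h; apply: Or31; apply: h => //; exact: ltW.
  - by move=> /eq_EFin_div h; apply: Or32; apply: h.
  - by move=> /eq_EFin_div h; apply: Or33; apply: h.
(* Positivity is read off the attained term: [gamma D] is positive with [D >= 0]. *)
have g0 : 0 < gamma.
  have pos D e : 0 <= D -> 0 < e -> gamma * D = e -> 0 < gamma.
    move=> D0 + gD; rewrite -gD => h; rewrite ltNge; apply/negP => gn.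
    by move: h; rewrite ltNge mulr_le0_ge0.
  by case: hc; apply: pos => //; exact: ltW.
split => //.
- by rewrite mulrC.
- by rewrite -D2E -exprMn exprn_ile1// mulr_ge0// ltW.
- case: hc => h; [exact: Or31| |exact: Or33].
  by apply: Or32; rewrite -D2E -exprMn h expr1n.
Qed.

(** Each term that may attain the stepsize is matched with one entry of the maximum: [sqrt n], the
    entry with [A], and [B / eps], in this order. *)
Lemma rr_budget (R : realType) (L A B eps gamma delta0 : R) (n T : nat) :
  0 < L -> (0 < n)%N -> 0 <= A -> 0 <= B -> 0 < eps -> 0 <= delta0 ->
  0 < gamma ->
  [\/ gamma * (2 * L * n%:R) = 1,
      gamma ^+ 3 * (A * L ^+ 2 * n%:R ^+ 2 * T%:R) = 1 |
      gamma * (2 * L * Num.sqrt n%:R * B) = eps] ->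
  48 * delta0 * L * Num.sqrt n%:R / eps ^+ 2 *
      Num.max (Num.sqrt n%:R)
        (Num.max (Num.sqrt (6 * delta0 * A) / eps) (B / eps)) <=
    T%:R * n%:R ->
  24 * delta0 <= gamma * n%:R * T%:R * eps ^+ 2.
Proof.
move=> L0 n0 A0 B0 e0 d0 g0 hc.
have nR0 : (0 : R) < n%:R by rewrite ltr0n.
have e20 : 0 < eps ^+ 2 by rewrite exprn_gt0.
have sn : Num.sqrt n%:R ^+ 2 = n%:R :> R by rewrite sqr_sqrtr// ltW.
have snp : 0 <= Num.sqrt n%:R :> R by exact: sqrtr_ge0.
set M := Num.max _ _; set q := Num.sqrt n%:R in sn snp hc M *.
move=> hT.
have c0 : 0 <= 48 * delta0 * L * q by rewrite !mulr_ge0// ltW.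
have bound x : x <= M -> 48 * delta0 * L * q * x <= T%:R * n%:R * eps ^+ 2.
  move=> xM; rewrite -ler_pdivrMr//; apply: le_trans hT.
  by rewrite mulrAC ler_wpM2l// divr_ge0// ltW.
have b1 : 48 * delta0 * L * q * q <= T%:R * n%:R * eps ^+ 2.
  by apply: bound; rewrite le_max lexx.
have b2 : 48 * delta0 * L * q * Num.sqrt (6 * delta0 * A) <=
    T%:R * n%:R * eps ^+ 3.
  have : Num.sqrt (6 * delta0 * A) / eps <= M by rewrite !le_max lexx orbT.
  move=> /bound; rewrite mulrA ler_pdivrMr//.
  by rewrite -[leRHS]mulrA -exprSr.
have b3 : 48 * delta0 * L * q * B <= T%:R * n%:R * eps ^+ 3.
  have : B / eps <= M by rewrite !le_max lexx !orbT.
  move=> /bound; rewrite mulrA ler_pdivrMr//.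
  by rewrite -[leRHS]mulrA -exprSr.
case: hc => hc.
- have := ler_wpM2l (ltW g0) b1; rewrite -[_ * q * q]mulrA -expr2 sn.
  have -> : gamma * (48 * delta0 * L * n%:R) =
    24 * delta0 * (gamma * (2 * L * n%:R)) by ring.
  by rewrite hc; lra.
- have {}b2 : (48 * delta0 * L * q * Num.sqrt (6 * delta0 * A)) ^+ 2 <=
      (T%:R * n%:R * eps ^+ 3) ^+ 2.
    by rewrite lerXn2r ?nnegrE ?mulr_ge0 ?sqrtr_ge0 ?exprn_ge0// ltW.
  rewrite exprMn sqr_sqrtr ?mulr_ge0// in b2.
  (* As [48 ^ 2 * 6 = 24 ^ 3], the squared bound becomes one on the cube of [24 * delta0], fitting
     the cubic equation for [gamma]. *)
  have e1 : (48 * delta0 * L * q) ^+ 2 * (6 * delta0 * A) =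
      (24 * delta0) ^+ 3 * (A * L ^+ 2) * n%:R.
    by rewrite -sn; ring.
  have {}b2 : (24 * delta0) ^+ 3 * (A * L ^+ 2) <=
      T%:R ^+ 2 * n%:R * eps ^+ 6.
    rewrite -(ler_pM2r nR0) -e1; apply: le_trans b2 _.
    by rewrite le_eqVlt; apply/orP; left; apply/eqP; ring.
  have p1 : 0 <= 24 * delta0 by rewrite mulr_ge0.
  have p2 : 0 <= gamma * n%:R * T%:R * eps ^+ 2.
    by rewrite mulr_ge0 ?sqr_ge0// !mulr_ge0// ltW.
  rewrite -(@ler_pXn2r _ 3)//.
  suff : (24 * delta0) ^+ 3 * (gamma ^+ 3 * (A * L ^+ 2 * n%:R ^+ 2 * T%:R)) <=
      (gamma * n%:R * T%:R * eps ^+ 2) ^+ 3 by rewrite hc mulr1.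
  have c1 : 0 <= gamma ^+ 3 * n%:R ^+ 2 * T%:R.
    by rewrite !mulr_ge0 ?exprn_ge0 ?(ltW g0).
  have := ler_wpM2l c1 b2.
  by congr (_ <= _); ring.
- rewrite -(ler_pM2r e0) -{1}hc.
  have := ler_wpM2l (ltW g0) b3.
  by congr (_ <= _); ring.
Qed.

Unset Implicit Arguments.
Set Strict Implicit.

Theorem corollary3 (R : realType) (d n : nat) (hn : (0 < n)%N)
    (f : 'I_n -> 'rV[R]_d -> R) (L A B fstar : R)
    (hdiff : forall i x, differentiable (f i) x)
    (hL : 0 < L)
    (hfL : smooth L (average f))
    (hfiL : forall i, smooth L (f i))
    (hlb : forall x, fstar <= average f x)
    (hA : 0 <= A) (hB : 0 <= B)
    (hvar : forall x,
      n%:R^-1 * \sum_(i < n)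
        enorm (gradient (f i) x - gradient (average f) x) ^+ 2
      <= 2 * A * (average f x - fstar) + B ^+ 2)
    (x0 : 'rV[R]_d) (delta0 eps gamma : R) (T : nat)
    (hdelta0 : delta0 = average f x0 - fstar)
    (heps : 0 < eps) (hT : (1 <= T)%N)
    (hgamma : gamma%:E = rr_stepsize L A B eps n T)
    (dO : measure_display) (Omega : measurableType dO)
    (P : probability Omega R)
    (pi : nat -> Omega -> 'S_n)
    (hpi_meas : forall t, (t < T)%N -> discrete_rv (pi t))
    (hpi_unif : forall t, (t < T)%N -> uniform_rv P (pi t))
    (hpi_indep : mutually_independent P (fun t : 'I_T => pi t))
    (hTn : T%:R * n%:R >=
      48 * delta0 * L * Num.sqrt n%:R / eps ^+ 2 *
      Num.max (Num.sqrt n%:R)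
        (Num.max (Num.sqrt (6 * delta0 * A) / eps) (B / eps))) :
  (\big[Order.min/+oo]_(t < T)
     'E_P[fun w => (enorm (gradient (average f)
            (rr_iterate f gamma x0 (fun k => pi k w) t)) ^+ 2)%R]
   <= (eps ^+ 2)%:E)%E.
Proof.
have [g0 gL hgA hgB hc] := rr_stepsizeP hL hn hT hA hB heps hgamma.
have d0 : 0 <= delta0 by rewrite hdelta0 subr_ge0.
have budget := rr_budget hL hn hA hB heps d0 g0 hc hTn.
pose m := mean_run f gamma x0 T.
have m0 t : 0 <= m (average f) t - fstar.
  rewrite subr_ge0.
  rewrite -(@mean_cst R {ffun 'I_T -> 'S_n} fstar (card_ffun_perm_gt0 n T)).
  by apply: ler_mean => s; exact: hlb.
have md0 : m (average f) 0%N - fstar = delta0.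
  by rewrite /m /mean_run /= mean_cst ?card_ffun_perm_gt0// hdelta0.
have nR0 : (0 : R) < n%:R by rewrite ltr0n.
(* The square of the third stepsize bound. It makes the noise term [b] of the recursion at most
   [gamma n eps ^ 2 / 6]. *)
have gB2 : gamma ^+ 2 * (4 * L ^+ 2 * n%:R * B ^+ 2) <= eps ^+ 2.
  have D30 : 0 <= gamma * (2 * L * Num.sqrt n%:R * B).
    by rewrite mulr_ge0 ?(ltW g0)// !mulr_ge0 ?sqrtr_ge0 ?(ltW hL).
  have : (gamma * (2 * L * Num.sqrt n%:R * B)) ^+ 2 <= eps ^+ 2.
    by rewrite lerXn2r ?nnegrE// ltW.
  rewrite -[in X in _ -> X](sqr_sqrtr (ltW nR0)).
  by congr (_ <= _); ring.
have hbe : 0 <= gamma * n%:R *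
    (eps ^+ 2 - gamma ^+ 2 * (4 * L ^+ 2 * n%:R * B ^+ 2)).
  by rewrite mulr_ge0 ?subr_ge0// mulr_ge0 ?ltW.
have ge0 : 0 <= gamma * n%:R * eps ^+ 2.
  by rewrite mulr_ge0 ?sqr_ge0// mulr_ge0 ?ltW.
have [] := @descent_exists_small R (4 / 3 * gamma ^+ 3 * L ^+ 2 * n%:R ^+ 2 * A)
  (7 / 18 * gamma * n%:R) (2 / 3 * gamma ^+ 3 * L ^+ 2 * n%:R ^+ 2 * B ^+ 2)
  (eps ^+ 2) (fun t => m (average f) t - fstar)
  (fun t => m (fun x => enorm (gradient (average f) x) ^+ 2) t) T.
- by rewrite mulr_ge0// mulr_ge0 ?sqr_ge0// mulr_ge0 ?sqr_ge0//
    mulr_ge0 ?exprn_ge0 ?ltW.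
- by lra.
- by rewrite !mulr_gt0.
- by lra.
- by [].
- exact: m0.
- by move=> t tT; apply: (mean_run_descent x0 hn hdiff hL hfL hfiL g0 gL hvar).
(* Here [c e - b] is at least [(7 / 18 - 1 / 6) gamma n eps ^ 2 = 2 / 9 gamma n eps ^ 2]. With
   [budget], [T] times this is at least [16 / 3 delta0], which exceeds or equals
   [81 / 16 delta0]. *)
- rewrite md0; have := ler_wpM2r (ler0n R T) hbe; rewrite mul0r; lra.
move=> t tT rt.
apply: (@bigmin_inf _ _ _ _ (Ordinal tT)) => //.
pose h (s : {ffun 'I_T -> 'S_n}) : R := enorm (gradient (average f)
  (rr_iterate f gamma x0 (extend_perms s) t)) ^+ 2.
(* The first [t] epochs see only permutations of index below [T], so the random sequence may be
   replaced by its finite tuple. *)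
rewrite (_ : (fun w => _) = (fun w => h [ffun k : 'I_T => pi k w])); last first.
  apply/funext => w; rewrite /h; congr (enorm (gradient _ _) ^+ 2).
  apply: rr_iterate_ext => k kt; have kT := ltn_trans kt tT.
  by rewrite -[k in RHS]/(val (Ordinal kT)) extend_permsE ffunE.
rewrite (@expectation_perm_run R n T dO Omega P pi h)// ?lee_fin//.
by move=> s; exact: sqr_ge0.
Qed.
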